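(* Let $\mathsf{C}$ be a strict braided monoidal category that admits equalizers. (Fundamental Theorem of Hopf modules.) Let $\mathbb{H}=(H_1,H_2,\sigma_H)$ be a Hopf truss in $\mathsf{C}$ and let $(M,\psi_M^1,\psi_M^2,\rho_M)$ be an object of the category $\mathbb{H}\text{-}\mathsf{Hopf\text{-}Mod}$ of left $\mathbb{H}$-Hopf modules. Let $M^{coH_1}$ be the equalizer object of $\rho_M$ and $\eta_H\otimes M$. Then $(M,\psi_M^1,\psi_M^2,\rho_M)$ and $\mathsf{F}(M^{coH_1})=(H\otimes M^{coH_1},\mu_H^1\otimes M^{coH_1},\mu_H^2\otimes M^{coH_1},\delta_H\otimes M^{coH_1})$ are isomorphic in $\mathbb{H}\text{-}\mathsf{Hopf\text{-}Mod}$.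
   Context: **Conventions.** $(\mathsf{C},\otimes,K,c)$ is a strict braided monoidal category with unit object $K$ and braiding $c$, admitting equalizers. For an object $P$ and a morphism $f$, $P\otimes f$ and $f\otimes P$ mean $id_P\otimes f$ and $f\otimes id_P$. Monoids $(A,\eta_A,\mu_A)$ (unit, product) and comonoids $(D,\varepsilon_D,\delta_D)$ (counit, coproduct) and their morphisms are the usual (co)associative (co)unital ones; left modules over a monoid and left comodules over a comonoid are the usual (co)unital ones. For comonoids $D,E$, $D\otimes E$ is a comonoid with $\varepsilon_{D\otimes E}=\varepsilon_D\otimes\varepsilon_E$, $\delta_{D\otimes E}=(D\otimes c_{D,E}\otimes E)\circ(\delta_D\otimes\delta_E)$. **Bimonoids, Hopf monoids.** A non-unital bimonoid is a comonoid $(B,\varepsilon_B,\delta_B)$ with an associative product $\mu_B:B\otimes B\to B$ (no unit required) that is a comonoid morphism. A bimonoid is an object that is a monoid and a comonoid such that unit and product are comonoid morphisms; a Hopf monoid is a bimonoid $H$ with an antipode $\lambda_H:H\to H$, i.e. $\mu_H\circ(H\otimes\lambda_H)\circ\delta_H=\eta_H\circ\varepsilon_H=\mu_H\circ(\lambda_H\otimes H)\circ\delta_H$. For a non-unital bimonoid $B$, a non-unital left $B$-module is $(M,\phi_M)$ with $\phi_M:B\otimes M\to M$ satisfying $\phi_M\circ(B\otimes\phi_M)=\phi_M\circ(\mu_B\otimes M)$. **Hopf trusses.** A Hopf truss $\mathbb{H}=(H_1,H_2,\sigma_H)$ in $\mathsf{C}$ consists of a comonoid $(H,\varepsilon_H,\delta_H)$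 together with $\eta_H,\mu_H^1,\mu_H^2,\lambda_H,\sigma_H$ such that $H_1=(H,\eta_H,\mu_H^1,\varepsilon_H,\delta_H,\lambda_H)$ is a Hopf monoid, $H_2=(H,\mu_H^2,\varepsilon_H,\delta_H)$ is a non-unital bimonoid, $\sigma_H:H\to H$ is a comonoid morphism, and $$\mu_H^2\circ(H\otimes\mu_H^1)=\mu_H^1\circ(\mu_H^2\otimes\Gamma_{H_1}^{\sigma_H})\circ(H\otimes c_{H,H}\otimes H)\circ(\delta_H\otimes H\otimes H),$$ where $\Gamma_{H_1}^{\sigma_H}=\mu_H^1\circ((\lambda_H\circ\sigma_H)\otimes\mu_H^2)\circ(\delta_H\otimes H)$. **Modules over a Hopf truss.** A left $\mathbb{H}$-module is a triple $(M,\psi_M^1,\psi_M^2)$ where $(M,\psi_M^1)$ is a left $H_1$-module, $(M,\psi_M^2)$ is a non-unital left $H_2$-module and $$\psi_M^2\circ(H\otimes\psi_M^1)=\psi_M^1\circ(\mu_H^2\otimes\Gamma_M^{\sigma_H})\circ(H\otimes c_{H,H}\otimes M)\circ(\delta_H\otimes H\otimes M),$$ with $\Gamma_M^{\sigma_H}=\psi_M^1\circ((\lambda_H\circ\sigma_H)\otimes\psi_M^2)\circ(\delta_H\otimes M)$. Morphisms are morphisms of $\mathsf{C}$ linear for both actions. **Hopf modules.** For a (non-unital) bimonoid $B$, a (non-unital) left $B$-Hopf module is a triple $(M,\varphi_M,\rho_M)$ with $(M,\varphi_M)$ a (non-unital) left $B$-module, $(M,\rho_M)$ a left $B$-comodule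 and $\rho_M\circ\varphi_M=(\mu_B\otimes\varphi_M)\circ(B\otimes c_{B,B}\otimes M)\circ(\delta_B\otimes\rho_M)$. A left $\mathbb{H}$-Hopf module is a 4-tuple $(M,\psi_M^1,\psi_M^2,\rho_M)$ such that (i) $(M,\psi_M^1,\psi_M^2)$ is a left $\mathbb{H}$-module; (ii) $(M,\psi_M^1,\rho_M)$ is a left $H_1$-Hopf module; (iii) $(M,\psi_M^2,\rho_M)$ is a non-unital left $H_2$-Hopf module; (iv) if $j_M:M^{coH_1}\to M$ is the equalizer morphism of $\rho_M$ and $\eta_H\otimes M$, then $\psi_M^1\circ(\sigma_H\otimes j_M)=\psi_M^2\circ(H\otimes j_M)$. Morphisms are morphisms of left $\mathbb{H}$-modules that are also morphisms of left $H$-comodules. The category is $\mathbb{H}\text{-}\mathsf{Hopf\text{-}Mod}$. *)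

(* Defs.v *)
From Stdlib Require Import ProofIrrelevance.
From mathcomp Require Import ssreflect.

Set Implicit Arguments.
Unset Strict Implicit.
Unset Printing Implicit Defensive.

Declare Scope cat_scope.
Delimit Scope cat_scope with cat.
Local Open Scope cat_scope.

Record category := Category {
  Ob :> Type;
  Hom : Ob -> Ob -> Type;
  idm : forall A, Hom A A;
  comp : forall A B C, Hom B C -> Hom A B -> Hom A C;
  comp_idl : forall A B (f : Hom A B), comp (idm B) f = f;
  comp_idr : forall A B (f : Hom A B), comp f (idm A) = f;
  compA : forall A B C D (h : Hom C D) (g : Hom B C) (f : Hom A B),
    comp h (comp g f) = comp (comp h g) f
}.

Arguments Hom {c}.
Arguments idm {c}.
Arguments comp {c A B C}.
Notation "A ~> B" := (Hom A B) (at level 90, no associativity) : type_scope.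
Notation "g ∘ f" := (comp g f) (at level 40, left associativity) : cat_scope.

Definition is_iso (C : category) (A B : C) (f : A ~> B) : Prop :=
  exists g : B ~> A, g ∘ f = idm A /\ f ∘ g = idm B.

Definition isomorphic (C : category) (A B : C) : Prop :=
  exists f : A ~> B, is_iso f.

Definition is_equalizer (C : category) (A B : C) (f g : A ~> B)
    (E : C) (j : E ~> A) : Prop :=
  f ∘ j = g ∘ j /\
  forall (X : C) (h : X ~> A), f ∘ h = g ∘ h -> exists! k : X ~> E, j ∘ k = h.

Record equalizers (C : category) := Equalizers {
  eqz_obj : forall (A B : C) (f g : A ~> B), C;
  eqz_mor : forall (A B : C) (f g : A ~> B), eqz_obj f g ~> A;
  eqz_spec : forall (A B : C) (f g : A ~> B), is_equalizer f g (eqz_mor f g)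
}.

(* The identity of A, regarded as a morphism to B along an equality of objects.
   In a strict monoidal category A ⊗ (B ⊗ C) and (A ⊗ B) ⊗ C are equal but not
   convertible, so the invisible identities between them have to be written. *)
Definition eqhom (C : category) (A B : C) (e : A = B) : A ~> B :=
  eq_rect A (fun X => A ~> X) (idm A) B e.

(* The last three fields are the strict equalities (f ⊗ g) ⊗ h = f ⊗ (g ⊗ h),
   K ⊗ f = f and f ⊗ K = f. *)
Record strict_monoidal := StrictMonoidal {
  sm_cat :> category;
  unitO : sm_cat;
  tens : sm_cat -> sm_cat -> sm_cat;
  tensm : forall A A' B B' : sm_cat,
    (A ~> A') -> (B ~> B') -> (tens A B ~> tens A' B');
  tensm_id : forall A B : sm_cat, tensm (idm A) (idm B) = idm (tens A B);
  tensm_comp : forall (A A' A'' B B' B'' : sm_cat)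
      (f' : A' ~> A'') (f : A ~> A') (g' : B' ~> B'') (g : B ~> B'),
    tensm (f' ∘ f) (g' ∘ g) = tensm f' g' ∘ tensm f g;
  tens_assoc : forall A B C : sm_cat, tens A (tens B C) = tens (tens A B) C;
  tens_unitl : forall A : sm_cat, tens unitO A = A;
  tens_unitr : forall A : sm_cat, tens A unitO = A;
  tensm_assoc : forall (A A' B B' C C' : sm_cat)
      (f : A ~> A') (g : B ~> B') (h : C ~> C'),
    eqhom (tens_assoc A' B' C') ∘ tensm f (tensm g h)
    = tensm (tensm f g) h ∘ eqhom (tens_assoc A B C);
  tensm_unitl : forall (A A' : sm_cat) (f : A ~> A'),
    eqhom (tens_unitl A') ∘ tensm (idm unitO) f = f ∘ eqhom (tens_unitl A);
  tensm_unitr : forall (A A' : sm_cat) (f : A ~> A'),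
    eqhom (tens_unitr A') ∘ tensm f (idm unitO) = f ∘ eqhom (tens_unitr A)
}.

Arguments unitO {s}.
Arguments tens {s}.
Arguments tensm {s A A' B B'}.
Notation "A ⊗ B" := (tens A B) (at level 35, right associativity) : cat_scope.
Notation "f ⊗₁ g" := (tensm f g) (at level 35, right associativity) : cat_scope.
Notation "'K" := unitO (at level 0) : cat_scope.

Section StrictIdentities.
Variable V : strict_monoidal.
Definition assoc (A B C : V) : A ⊗ (B ⊗ C) ~> (A ⊗ B) ⊗ C :=
  eqhom (tens_assoc A B C).
Definition assoc_inv (A B C : V) : (A ⊗ B) ⊗ C ~> A ⊗ (B ⊗ C) :=
  eqhom (eq_sym (tens_assoc A B C)).
Definition lunit (A : V) : 'K ⊗ A ~> A := eqhom (tens_unitl A).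
Definition lunit_inv (A : V) : A ~> 'K ⊗ A := eqhom (eq_sym (tens_unitl A)).
Definition runit (A : V) : A ⊗ 'K ~> A := eqhom (tens_unitr A).
Definition runit_inv (A : V) : A ~> A ⊗ 'K := eqhom (eq_sym (tens_unitr A)).
End StrictIdentities.

(* The hexagons read c_{A,B⊗C} = (B ⊗ c_{A,C}) ∘ (c_{A,B} ⊗ C) and
   c_{A⊗B,C} = (c_{A,C} ⊗ B) ∘ (A ⊗ c_{B,C}). *)
Record strict_braided := StrictBraided {
  sb_mon :> strict_monoidal;
  braid : forall A B : sb_mon, A ⊗ B ~> B ⊗ A;
  braid_iso : forall A B : sb_mon, is_iso (braid A B);
  braid_nat : forall (A A' B B' : sb_mon) (f : A ~> A') (g : B ~> B'),
    braid A' B' ∘ (f ⊗₁ g) = (g ⊗₁ f) ∘ braid A B;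
  braid_hexr : forall A B C : sb_mon,
    braid A (B ⊗ C)
    = assoc B C A ∘ (idm B ⊗₁ braid A C) ∘ assoc_inv B A C
      ∘ (braid A B ⊗₁ idm C) ∘ assoc A B C;
  braid_hexl : forall A B C : sb_mon,
    braid (A ⊗ B) C
    = assoc_inv C A B ∘ (braid A C ⊗₁ idm B) ∘ assoc A C B
      ∘ (idm A ⊗₁ braid B C) ∘ assoc_inv A B C
}.

Section Structures.
Variable V : strict_braided.

(* A ⊗ c_{B,C} ⊗ D *)
Definition midbraid (A B C D : V) : (A ⊗ B) ⊗ (C ⊗ D) ~> (A ⊗ C) ⊗ (B ⊗ D) :=
  assoc A C (B ⊗ D)
  ∘ (idm A ⊗₁ (assoc_inv C B D ∘ (braid B C ⊗₁ idm D) ∘ assoc B C D))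
  ∘ assoc_inv A B (C ⊗ D).

Record comonoid_data := ComonoidData {
  cm_obj :> V;
  counit : cm_obj ~> 'K;
  coprod : cm_obj ~> cm_obj ⊗ cm_obj
}.

Record is_comonoid (D : comonoid_data) : Prop := IsComonoid {
  coprod_coassoc :
    (coprod D ⊗₁ idm D) ∘ coprod D
    = assoc D D D ∘ (idm D ⊗₁ coprod D) ∘ coprod D;
  counit_coprodl : lunit D ∘ (counit D ⊗₁ idm D) ∘ coprod D = idm D;
  counit_coprodr : runit D ∘ (idm D ⊗₁ counit D) ∘ coprod D = idm D
}.

Definition unit_comonoid : comonoid_data :=
  @ComonoidData 'K (idm 'K) (lunit_inv 'K).

Definition tens_comonoid (D E : comonoid_data) : comonoid_data :=
  @ComonoidData (D ⊗ E)
    (lunit 'K ∘ (counit D ⊗₁ counit E))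
    (midbraid D D E E ∘ (coprod D ⊗₁ coprod E)).

Definition is_comonoid_mor (D E : comonoid_data) (f : D ~> E) : Prop :=
  counit E ∘ f = counit D /\ coprod E ∘ f = (f ⊗₁ f) ∘ coprod D.

Definition is_assoc (A : V) (mu : A ⊗ A ~> A) : Prop :=
  mu ∘ (idm A ⊗₁ mu) = mu ∘ (mu ⊗₁ idm A) ∘ assoc A A A.

Record is_monoid (A : V) (eta : 'K ~> A) (mu : A ⊗ A ~> A) : Prop := IsMonoid {
  monoid_assoc : is_assoc mu;
  monoid_unitl : mu ∘ (eta ⊗₁ idm A) = lunit A;
  monoid_unitr : mu ∘ (idm A ⊗₁ eta) = runit A
}.

Record is_nonunital_bimonoid (B : comonoid_data) (mu : B ⊗ B ~> B) : Prop :=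
  IsNonunitalBimonoid {
  nub_comonoid : is_comonoid B;
  nub_assoc : is_assoc mu;
  nub_mu : @is_comonoid_mor (tens_comonoid B B) B mu
}.

Record is_bimonoid (B : comonoid_data) (eta : 'K ~> B) (mu : B ⊗ B ~> B)
    : Prop := IsBimonoid {
  bim_comonoid : is_comonoid B;
  bim_monoid : is_monoid eta mu;
  bim_eta : @is_comonoid_mor unit_comonoid B eta;
  bim_mu : @is_comonoid_mor (tens_comonoid B B) B mu
}.

Record is_hopf_monoid (H : comonoid_data) (eta : 'K ~> H) (mu : H ⊗ H ~> H)
    (lam : H ~> H) : Prop := IsHopfMonoid {
  hopf_bimonoid : is_bimonoid eta mu;
  hopf_antipoder : mu ∘ (idm H ⊗₁ lam) ∘ coprod H = eta ∘ counit H;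
  hopf_antipodel : mu ∘ (lam ⊗₁ idm H) ∘ coprod H = eta ∘ counit H
}.

Definition is_nonunital_module (A : V) (mu : A ⊗ A ~> A)
    (M : V) (phi : A ⊗ M ~> M) : Prop :=
  phi ∘ (idm A ⊗₁ phi) = phi ∘ (mu ⊗₁ idm M) ∘ assoc A A M.

Definition is_module (A : V) (eta : 'K ~> A) (mu : A ⊗ A ~> A)
    (M : V) (phi : A ⊗ M ~> M) : Prop :=
  is_nonunital_module mu phi /\ phi ∘ (eta ⊗₁ idm M) = lunit M.

Definition is_comodule (D : comonoid_data) (M : V) (rho : M ~> D ⊗ M) : Prop :=
  (coprod D ⊗₁ idm M) ∘ rho = assoc D D M ∘ (idm D ⊗₁ rho) ∘ rho /\
  lunit M ∘ (counit D ⊗₁ idm M) ∘ rho = idm M.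

Definition hopf_compat (B : comonoid_data) (mu : B ⊗ B ~> B)
    (M : V) (phi : B ⊗ M ~> M) (rho : M ~> B ⊗ M) : Prop :=
  rho ∘ phi = (mu ⊗₁ phi) ∘ midbraid B B B M ∘ (coprod B ⊗₁ rho).

Record is_nonunital_hopf_module (B : comonoid_data) (mu : B ⊗ B ~> B)
    (M : V) (phi : B ⊗ M ~> M) (rho : M ~> B ⊗ M) : Prop :=
  IsNonunitalHopfModule {
  nuhm_module : is_nonunital_module mu phi;
  nuhm_comodule : is_comodule rho;
  nuhm_compat : hopf_compat mu phi rho
}.

Record is_hopf_module (B : comonoid_data) (eta : 'K ~> B) (mu : B ⊗ B ~> B)
    (M : V) (phi : B ⊗ M ~> M) (rho : M ~> B ⊗ M) : Prop := IsHopfModule {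
  hm_module : is_module eta mu phi;
  hm_comodule : is_comodule rho;
  hm_compat : hopf_compat mu phi rho
}.

(* For psi1 = mu1 and psi2 = mu2 this is Γ_{H_1}^{σ_H}. *)
Definition Gamma (H : comonoid_data) (lam sigma : H ~> H) (M : V)
    (psi1 psi2 : H ⊗ M ~> M) : H ⊗ M ~> M :=
  psi1 ∘ ((lam ∘ sigma) ⊗₁ psi2) ∘ assoc_inv H H M ∘ (coprod H ⊗₁ idm M).

Record hopf_truss := HopfTruss {
  ht_com :> comonoid_data;
  ht_eta : 'K ~> ht_com;
  ht_mu1 : ht_com ⊗ ht_com ~> ht_com;
  ht_mu2 : ht_com ⊗ ht_com ~> ht_com;
  ht_lam : ht_com ~> ht_com;
  ht_sigma : ht_com ~> ht_com;
  ht_hopf : is_hopf_monoid ht_eta ht_mu1 ht_lam;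
  ht_bimonoid : is_nonunital_bimonoid ht_mu2;
  ht_sigma_mor : is_comonoid_mor ht_sigma;
  ht_compat :
    ht_mu2 ∘ (idm ht_com ⊗₁ ht_mu1)
    = ht_mu1 ∘ (ht_mu2 ⊗₁ Gamma ht_lam ht_sigma ht_mu1 ht_mu2)
      ∘ midbraid ht_com ht_com ht_com ht_com
      ∘ (coprod ht_com ⊗₁ idm (ht_com ⊗ ht_com))
}.

Variable E : equalizers V.

Section HopfTrussModules.
Variable H : hopf_truss.

Record is_truss_module (M : V) (psi1 psi2 : H ⊗ M ~> M) : Prop :=
  IsTrussModule {
  tm_module1 : is_module (ht_eta H) (ht_mu1 H) psi1;
  tm_module2 : is_nonunital_module (ht_mu2 H) psi2;
  tm_compat :
    psi2 ∘ (idm H ⊗₁ psi1)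
    = psi1 ∘ (ht_mu2 H ⊗₁ Gamma (ht_lam H) (ht_sigma H) psi1 psi2)
      ∘ midbraid H H H M ∘ (coprod H ⊗₁ idm (H ⊗ M))
}.

Record truss_hopf_data := TrussHopfData {
  th_obj :> V;
  psi1 : H ⊗ th_obj ~> th_obj;
  psi2 : H ⊗ th_obj ~> th_obj;
  rho : th_obj ~> H ⊗ th_obj
}.

Definition eta_tens (M : V) : M ~> H ⊗ M := (ht_eta H ⊗₁ idm M) ∘ lunit_inv M.

Definition coinv (M : truss_hopf_data) : V := eqz_obj E (rho M) (eta_tens M).
Definition coinv_mor (M : truss_hopf_data) : coinv M ~> M :=
  eqz_mor E (rho M) (eta_tens M).

Record is_truss_hopf_module (M : truss_hopf_data) : Prop :=
  IsTrussHopfModule {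
  thm_module : is_truss_module (psi1 M) (psi2 M);
  thm_hopf1 : is_hopf_module (ht_eta H) (ht_mu1 H) (psi1 M) (rho M);
  thm_hopf2 : is_nonunital_hopf_module (ht_mu2 H) (psi2 M) (rho M);
  thm_coinv :
    psi1 M ∘ (ht_sigma H ⊗₁ coinv_mor M) = psi2 M ∘ (idm H ⊗₁ coinv_mor M)
}.

Record is_truss_hopf_mor (M N : truss_hopf_data) (f : M ~> N) : Prop :=
  IsTrussHopfMor {
  thf_lin1 : f ∘ psi1 M = psi1 N ∘ (idm H ⊗₁ f);
  thf_lin2 : f ∘ psi2 M = psi2 N ∘ (idm H ⊗₁ f);
  thf_colin : rho N ∘ f = (idm H ⊗₁ f) ∘ rho M
}.

Record truss_hopf_module := TrussHopfModule {
  thm_data :> truss_hopf_data;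
  thm_spec : is_truss_hopf_module thm_data
}.

Record truss_hopf_hom (M N : truss_hopf_module) := TrussHopfHom {
  thh_mor :> M ~> N;
  thh_spec : is_truss_hopf_mor thh_mor
}.

Lemma truss_hopf_hom_eq (M N : truss_hopf_module) (f g : truss_hopf_hom M N) :
  thh_mor f = thh_mor g -> f = g.
Proof.
case: f g => [f pf] [g pg] /= e; subst g.
by rewrite (proof_irrelevance _ pf pg).
Qed.

Lemma truss_hopf_mor_id (M : truss_hopf_data) :
  @is_truss_hopf_mor M M (idm M).
Proof. by split; rewrite tensm_id comp_idl comp_idr. Qed.

Lemma truss_hopf_mor_comp (M N P : truss_hopf_data) (g : N ~> P) (f : M ~> N) :
  is_truss_hopf_mor g -> is_truss_hopf_mor f ->
  @is_truss_hopf_mor M P (g ∘ f).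
Proof.
case=> [g1 g2 g3] [f1 f2 f3].
have E0 : idm H ⊗₁ (g ∘ f) = (idm H ⊗₁ g) ∘ (idm H ⊗₁ f).
  by rewrite -tensm_comp comp_idl.
split; rewrite E0.
- by rewrite -compA f1 compA g1 -compA.
- by rewrite -compA f2 compA g2 -compA.
- by rewrite compA g3 -compA f3 compA.
Qed.

Definition HopfMod : category.
Proof.
refine (@Category truss_hopf_module truss_hopf_hom
  (fun M => TrussHopfHom (truss_hopf_mor_id M))
  (fun M N P g f =>
     TrussHopfHom (truss_hopf_mor_comp (thh_spec g) (thh_spec f)))
  _ _ _).
- by move=> M N f; apply: truss_hopf_hom_eq; rewrite /= comp_idl.
- by move=> M N f; apply: truss_hopf_hom_eq; rewrite /= comp_idr.
- by move=> M N P Q h g f; apply: truss_hopf_hom_eq; rewrite /= compA.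
Defined.

(* F(X) = (H ⊗ X, mu1 ⊗ X, mu2 ⊗ X, delta ⊗ X), up to the invisible identities *)
Definition free_truss_hopf (X : V) : truss_hopf_data :=
  @TrussHopfData (H ⊗ X)
    ((ht_mu1 H ⊗₁ idm X) ∘ assoc H H X)
    ((ht_mu2 H ⊗₁ idm X) ∘ assoc H H X)
    (assoc_inv H H X ∘ (coprod H ⊗₁ idm X)).

End HopfTrussModules.
End Structures.

(* Main.v *)
(* Write q(m) = S(m_{-1}) m_0.  The usual argument shows that H ⊗ M^{co} → M,
   h ⊗ x ↦ h x, is inverse to m ↦ m_{-1} ⊗ q(m_0), provided that q lands in the
   coinvariants.  The latter is obtained without anti-multiplicativity of the
   antipode: for the diagonal action of H on H ⊗ M, the map a ↦ m_{-1} a(m_0) is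
   injective on arrows a : M → H ⊗ M, and it sends both rho ∘ q and η ⊗ q to rho.
   For linearity over the second product and for the condition on coinvariants of
   the free module the additional input is σ(h) = h ∘ 1, where ∘ is the second
   product: inserting units in the truss axiom gives s = s * (Sσ) * s in the
   convolution monoid for s(h) = h ∘ 1, and s is a comonoid morphism, hence
   convolution invertible.

   The bookkeeping of the strict associativity identities is avoided by replacing
   every f by the natural transformation f ⊗ X, with source and target bracketed
   to the right: in this form all axioms are equations between plain composites. *)

From Stdlib Require Import ProofIrrelevance.
From mathcomp Require Import ssreflect ssrfun ssrbool.
Require Import Defs.

Set Implicit Arguments.
Unset Strict Implicit.
Unset Printing Implicit Defensive.

Local Open Scope cat_scope.

Local Notation "A ◁ f" := (idm A ⊗₁ f) (at level 35, right associativity).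

(* Equality of morphisms up to the invisible identities of a strict category. *)
Definition heq (C : category) (A B A' B' : C) (f : A ~> B) (g : A' ~> B') :=
  exists (a : A = A') (b : B = B'), eqhom b ∘ f = g ∘ eqhom a.

Local Notation "f ≈ g" := (heq f g) (at level 70, no associativity).

(** * Comparison of morphisms along equalities of their sources and targets *)

Section Heq.
Variable C : category.

(* preNM turns an equation between composites of N and of M arrows into a
   rewrite rule for right-nested composites. *)
Lemma pre21 (A B D : C) (f : B ~> D) (g : A ~> B) (h : A ~> D) :
  f ∘ g = h -> forall (Z : C) (k : Z ~> A), f ∘ (g ∘ k) = h ∘ k.
Proof. by move=> e Z k; rewrite compA e. Qed.

Lemma pre32 (A B B' D E : C) (f : B ~> D) (g : B' ~> B) (h : A ~> B')
    (p : E ~> D) (q : A ~> E) :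
  f ∘ (g ∘ h) = p ∘ q ->
  forall (Z : C) (k : Z ~> A), f ∘ (g ∘ (h ∘ k)) = p ∘ (q ∘ k).
Proof. by move=> e Z k; rewrite !compA -e !compA. Qed.

Lemma pre22 (A B B' D : C) (f : B ~> D) (g : A ~> B) (f' : B' ~> D)
  (g' : A ~> B') :
  f ∘ g = f' ∘ g' ->
  forall (Z : C) (k : Z ~> A), f ∘ (g ∘ k) = f' ∘ (g' ∘ k).
Proof. by move=> e Z k; rewrite !compA e. Qed.

(** By proof irrelevance every proof of [A = A] is reflexivity; this is how the invisible identities
    are discharged. *)
Lemma eqhom_id (A : C) (e : A = A) : eqhom e = idm A.
Proof. by rewrite (proof_irrelevance _ e eq_refl). Qed.

Lemma heq_refl (A B : C) (f : A ~> B) : f ≈ f.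
Proof. by exists eq_refl, eq_refl; rewrite !eqhom_id comp_idl comp_idr. Qed.

Lemma heq_eq (A B : C) (f g : A ~> B) : f ≈ g -> f = g.
Proof. by case=> a [b]; rewrite !eqhom_id comp_idl comp_idr. Qed.

Lemma heq_sym (A B A' B' : C) (f : A ~> B) (g : A' ~> B') : f ≈ g -> g ≈ f.
Proof.
case=> a [b]; case: A' / a g => g; case: B' / b g => g.
by rewrite !eqhom_id comp_idl comp_idr => ->; exact: heq_refl.
Qed.

Lemma heq_trans (A B A' B' A'' B'' : C)
    (f : A ~> B) (g : A' ~> B') (h : A'' ~> B'') : f ≈ g -> g ≈ h -> f ≈ h.
Proof.
case=> a [b]; case: A' / a g => g; case: B' / b g => g.
by rewrite !eqhom_id comp_idl comp_idr => ->.
Qed.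

Lemma heq_comp (A B D A' B' D' : C)
    (f : B ~> D) (g : A ~> B) (f' : B' ~> D') (g' : A' ~> B') :
  f ≈ f' -> g ≈ g' -> f ∘ g ≈ f' ∘ g'.
Proof.
case=> b [d]; case: B' / b f' g' => f' g'; case: D' / d f' => f'.
rewrite !eqhom_id comp_idl comp_idr => ->.
case=> a [b]; case: A' / a g' => g'.
by rewrite !eqhom_id comp_idl comp_idr => ->; exact: heq_refl.
Qed.

Lemma heq_eqhom (A B : C) (e : A = B) : eqhom e ≈ idm A.
Proof. by case: B / e; rewrite eqhom_id; exact: heq_refl. Qed.

Lemma heq_eqhom_cod (A B : C) (e : A = B) : eqhom e ≈ idm B.
Proof. by case: B / e; exact: heq_refl. Qed.

Lemma heq_eqhoml (A B D A' B' : C) (e : B = D) (f : A ~> B) (g : A' ~> B') :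
  f ≈ g -> eqhom e ∘ f ≈ g.
Proof. by case: D / e; rewrite eqhom_id comp_idl. Qed.

Lemma heq_eqhomr (A B D A' B' : C) (e : D = A) (f : A ~> B) (g : A' ~> B') :
  f ≈ g -> f ∘ eqhom e ≈ g.
Proof. by move: f; case: A / e => f; rewrite eqhom_id comp_idr. Qed.

End Heq.

(** * Strictness of the tensor product and whiskering *)

Section Strict.
Variable V : strict_monoidal.
Implicit Types A B D X Y : V.

Lemma heq_tens A B A' B' A1 B1 A1' B1' (f : A ~> B) (g : A' ~> B')
    (f1 : A1 ~> B1) (g1 : A1' ~> B1') : f ≈ f1 -> g ≈ g1 -> f ⊗₁ g ≈ f1 ⊗₁ g1.
Proof.
case=> a [b]; case: A1 / a f1 => f1; case: B1 / b f1 => f1.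
rewrite !eqhom_id comp_idl comp_idr => ->.
case=> a [b]; case: A1' / a g1 => g1; case: B1' / b g1 => g1.
by rewrite !eqhom_id comp_idl comp_idr => ->; exact: heq_refl.
Qed.

Lemma heq_tensA A B A' B' A'' B'' (f : A ~> B) (g : A' ~> B') (h : A'' ~> B'') :
  f ⊗₁ (g ⊗₁ h) ≈ (f ⊗₁ g) ⊗₁ h.
Proof. by do 2 eexists; exact: tensm_assoc. Qed.

Lemma heq_tens1l A B (f : A ~> B) : 'K ◁ f ≈ f.
Proof. by do 2 eexists; exact: tensm_unitl. Qed.

Lemma heq_tens1r A B (f : A ~> B) : f ⊗₁ idm 'K ≈ f.
Proof. by do 2 eexists; exact: tensm_unitr. Qed.

Lemma whiskD A X Y Z (g : Y ~> Z) (f : X ~> Y) :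
  A ◁ (g ∘ f) = (A ◁ g) ∘ (A ◁ f).
Proof. by rewrite -tensm_comp comp_idl. Qed.

Lemma wh21 A X Y Z (g : Y ~> Z) (f : X ~> Y) h :
  g ∘ f = h -> (A ◁ g) ∘ (A ◁ f) = A ◁ h.
Proof. by rewrite -whiskD => ->. Qed.

Lemma wh22 A X Y Y' Z (g : Y ~> Z) (f : X ~> Y) (g' : Y' ~> Z) (f' : X ~> Y') :
  g ∘ f = g' ∘ f' -> (A ◁ g) ∘ (A ◁ f) = (A ◁ g') ∘ (A ◁ f').
Proof. by rewrite -!whiskD => ->. Qed.

Lemma tensm_idD A X Y Z (g : Y ~> Z) (f : X ~> Y) :
  (g ∘ f) ⊗₁ idm A = (g ⊗₁ idm A) ∘ (f ⊗₁ idm A).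
Proof. by rewrite -tensm_comp comp_idl. Qed.

Lemma tens_split A A' B B' (f : A ~> A') (g : B ~> B') :
  f ⊗₁ g = (f ⊗₁ idm B') ∘ (A ◁ g).
Proof. by rewrite -tensm_comp comp_idl comp_idr. Qed.

Lemma tens_splitr A A' B B' (f : A ~> A') (g : B ~> B') :
  f ⊗₁ g = (A' ◁ g) ∘ (f ⊗₁ idm B).
Proof. by rewrite -tensm_comp comp_idl comp_idr. Qed.

(** * Morphisms tensored with an object on the right *)

Fact placed_key : unit. Proof. exact: tt. Qed.

(* f ⊗ X, bracketed to the right.  The definitions are locked because rewriting
   with compA would otherwise unfold them. *)
Definition op2 A B D (f : A ⊗ B ~> D) X : A ⊗ B ⊗ X ~> D ⊗ X :=
  locked_with placed_key ((f ⊗₁ idm X) ∘ assoc A B X).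
Definition cop2 A B D (f : D ~> A ⊗ B) X : D ⊗ X ~> A ⊗ B ⊗ X :=
  locked_with placed_key (assoc_inv A B X ∘ (f ⊗₁ idm X)).
Definition op0 A (f : 'K ~> A) X : X ~> A ⊗ X :=
  locked_with placed_key ((f ⊗₁ idm X) ∘ lunit_inv X).
Definition cop0 A (f : A ~> 'K) X : A ⊗ X ~> X :=
  locked_with placed_key (lunit X ∘ (f ⊗₁ idm X)).

Lemma op2E A B D (f : A ⊗ B ~> D) X : op2 f X = (f ⊗₁ idm X) ∘ assoc A B X.
Proof. exact: locked_withE. Qed.
Lemma cop2E A B D (f : D ~> A ⊗ B) X :
  cop2 f X = assoc_inv A B X ∘ (f ⊗₁ idm X).
Proof. exact: locked_withE. Qed.
Lemma op0E A (f : 'K ~> A) X : op0 f X = (f ⊗₁ idm X) ∘ lunit_inv X.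
Proof. exact: locked_withE. Qed.
Lemma cop0E A (f : A ~> 'K) X : cop0 f X = lunit X ∘ (f ⊗₁ idm X).
Proof. exact: locked_withE. Qed.

Lemma op2_heq A B D (f : A ⊗ B ~> D) X : op2 f X ≈ f ⊗₁ idm X.
Proof. rewrite op2E; exact/heq_eqhomr/heq_refl. Qed.
Lemma cop2_heq A B D (f : D ~> A ⊗ B) X : cop2 f X ≈ f ⊗₁ idm X.
Proof. rewrite cop2E; exact/heq_eqhoml/heq_refl. Qed.
Lemma op0_heq A (f : 'K ~> A) X : op0 f X ≈ f ⊗₁ idm X.
Proof. rewrite op0E; exact/heq_eqhomr/heq_refl. Qed.
Lemma cop0_heq A (f : A ~> 'K) X : cop0 f X ≈ f ⊗₁ idm X.
Proof. rewrite cop0E; exact/heq_eqhoml/heq_refl. Qed.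

Lemma op2_nat A B D (f : A ⊗ B ~> D) X Y (g : X ~> Y) :
  op2 f Y ∘ (A ◁ B ◁ g) = (D ◁ g) ∘ op2 f X.
Proof.
rewrite !op2E -compA tensm_assoc !compA tensm_id.
by congr (_ ∘ _); rewrite -tens_split -tens_splitr.
Qed.

Lemma assocK A B D : assoc_inv A B D ∘ assoc A B D = idm _.
Proof. exact/heq_eq/heq_eqhoml/heq_eqhom. Qed.

Lemma assoc_inv_nat A B D A' B' D' (f : A ~> A') (g : B ~> B') (h : D ~> D') :
  assoc_inv A' B' D' ∘ ((f ⊗₁ g) ⊗₁ h) = (f ⊗₁ g ⊗₁ h) ∘ assoc_inv A B D.
Proof.
apply/heq_eq/heq_eqhoml/heq_sym/heq_eqhomr; exact: heq_tensA.
Qed.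

Lemma cop2_nat A B D (f : D ~> A ⊗ B) X Y (g : X ~> Y) :
  cop2 f Y ∘ (D ◁ g) = (A ◁ B ◁ g) ∘ cop2 f X.
Proof.
rewrite !cop2E -compA -tens_split tens_splitr -tensm_id compA assoc_inv_nat.
by rewrite compA.
Qed.

Lemma op0_nat A (f : 'K ~> A) X Y (g : X ~> Y) :
  op0 f Y ∘ g = (A ◁ g) ∘ op0 f X.
Proof.
apply: heq_eq; apply: (@heq_trans _ _ _ _ _ _ _ _ (f ⊗₁ g)).
  rewrite (tens_split f); apply: heq_comp; first exact: op0_heq.
  exact/heq_sym/heq_tens1l.
by rewrite (tens_splitr f); apply: heq_comp;
  [exact: heq_refl|exact/heq_sym/op0_heq].
Qed.

Lemma cop0_nat A (f : A ~> 'K) X Y (g : X ~> Y) :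
  cop0 f Y ∘ (A ◁ g) = g ∘ cop0 f X.
Proof.
apply: heq_eq; apply: (@heq_trans _ _ _ _ _ _ _ _ (f ⊗₁ g)).
  by rewrite (tens_split f); apply: heq_comp; [exact: cop0_heq|exact: heq_refl].
rewrite (tens_splitr f); apply: heq_comp; first exact: heq_tens1l.
exact/heq_sym/cop0_heq.
Qed.

Lemma heq_eqhom_tensl A B D X A' B' (e : B = D) (f : A ~> B ⊗ X) (g : A' ~> B')
  :
  f ≈ g -> (eqhom e ⊗₁ idm X) ∘ f ≈ g.
Proof. by case: D / e; rewrite eqhom_id tensm_id comp_idl. Qed.

Lemma heq_eqhom_tensr A B D X A' B' (e : D = A) (f : A ⊗ X ~> B) (g : A' ~> B')
  :
  f ≈ g -> f ∘ (eqhom e ⊗₁ idm X) ≈ g.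
Proof. by move: f; case: A / e => f; rewrite eqhom_id tensm_id comp_idr. Qed.

Lemma tens_shift A B D X (f : A ~> B) :
  f ⊗₁ idm (D ⊗ X) ≈ (f ⊗₁ idm D) ⊗₁ idm X.
Proof. by rewrite -tensm_id; exact: heq_tensA. Qed.

Lemma op2_shift A B D (f : A ⊗ B ~> D) Y X :
  op2 f (Y ⊗ X) ≈ op2 f Y ⊗₁ idm X.
Proof.
apply: heq_trans (op2_heq _ _) _; apply: heq_trans (tens_shift _ _ _) _.
apply: heq_tens (heq_refl _); exact/heq_sym/op2_heq.
Qed.

Lemma cop2_shift A B D (f : D ~> A ⊗ B) Y X :
  cop2 f (Y ⊗ X) ≈ cop2 f Y ⊗₁ idm X.
Proof.
apply: heq_trans (cop2_heq _ _) _; apply: heq_trans (tens_shift _ _ _) _.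
apply: heq_tens (heq_refl _); exact/heq_sym/cop2_heq.
Qed.

(** [cop2_shift] handles the object [(Y ⊗ Z) ⊗ X]; eliminating [tens_assoc] brackets it to the
    right, as in [δ (H ⊗ H ⊗ X)]. *)
Lemma cop2_shift2 A B D (f : D ~> A ⊗ B) Y Z X :
  cop2 f (Y ⊗ Z ⊗ X) ≈ cop2 f (Y ⊗ Z) ⊗₁ idm X.
Proof.
apply: heq_trans (cop2_shift _ _ _).
by case: _ / (tens_assoc Y Z X); exact: heq_refl.
Qed.

Lemma op0_shift A (f : 'K ~> A) Y X : op0 f (Y ⊗ X) ≈ op0 f Y ⊗₁ idm X.
Proof.
apply: heq_trans (op0_heq _ _) _; apply: heq_trans (tens_shift _ _ _) _.
apply: heq_tens (heq_refl _); exact/heq_sym/op0_heq.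
Qed.

Lemma cop0_shift A (f : A ~> 'K) Y X : cop0 f (Y ⊗ X) ≈ cop0 f Y ⊗₁ idm X.
Proof.
apply: heq_trans (cop0_heq _ _) _; apply: heq_trans (tens_shift _ _ _) _.
apply: heq_tens (heq_refl _); exact/heq_sym/cop0_heq.
Qed.

Lemma whisk_heq A B D Y Z X (f : Y ~> Z) (g : B ~> D) :
  f ≈ g ⊗₁ idm X -> A ◁ f ≈ (A ◁ g) ⊗₁ idm X.
Proof.
move=> h; apply: heq_trans (heq_tens (heq_refl _) h) _; exact: heq_tensA.
Qed.

Lemma comp_heq A B D X Y Z W (f : Y ~> Z) (f' : X ~> Y)
    (g : B ~> D) (g' : A ~> B) :
  f ≈ g ⊗₁ idm W -> f' ≈ g' ⊗₁ idm W -> f ∘ f' ≈ (g ∘ g') ⊗₁ idm W.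
Proof. by move=> h h'; rewrite tensm_idD; exact: heq_comp. Qed.

(** The pattern of most proofs of right-bracketed axioms below: both sides are recognized as one
    morphism without [X], tensored with [X]. *)
Lemma heq_uniq A B X Y (f f' : A ~> B) (g : X ~> Y) : f ≈ g -> f' ≈ g -> f = f'.
Proof. by move=> h /heq_sym h'; exact/heq_eq/(heq_trans h). Qed.

End Strict.

(** * The braiding tensored with an object on the right *)

Section PlacedBraid.
Variable V : strict_braided.
Implicit Types A B D X Y : V.

Definition br A B X : A ⊗ B ⊗ X ~> B ⊗ A ⊗ X :=
  locked_with placed_key
    (assoc_inv B A X ∘ (braid A B ⊗₁ idm X) ∘ assoc A B X).

Lemma brE A B X :
  br A B X = assoc_inv B A X ∘ (braid A B ⊗₁ idm X) ∘ assoc A B X.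
Proof. exact: locked_withE. Qed.

Lemma br_heq A B X : br A B X ≈ braid A B ⊗₁ idm X.
Proof. rewrite brE; exact/heq_eqhomr/heq_eqhoml/heq_refl. Qed.

Lemma br_shift A B Y X : br A B (Y ⊗ X) ≈ br A B Y ⊗₁ idm X.
Proof.
apply: heq_trans (br_heq _ _ _) _; apply: heq_trans (tens_shift _ _ _) _.
apply: heq_tens (heq_refl _); exact/heq_sym/br_heq.
Qed.

Lemma br_nat A B X Y (g : X ~> Y) :
  br A B Y ∘ (A ◁ B ◁ g) = (B ◁ A ◁ g) ∘ br A B X.
Proof.
have := op2_nat (braid A B) g; rewrite !brE !op2E -!compA => ->.
by rewrite !compA -tensm_id assoc_inv_nat.
Qed.

End PlacedBraid.

(* Proves f ≈ g ⊗₁ idm X when f is g with X added to the right of its rightmost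
   tensor factors. *)
Ltac place :=
  repeat first
    [ apply: op2_heq | apply: cop2_heq | apply: op0_heq | apply: cop0_heq
    | apply: op2_shift | apply: cop2_shift | apply: cop2_shift2
    | apply: op0_shift | apply: cop0_shift | apply: br_heq | apply: br_shift
    | apply: tens_shift | apply: heq_refl
    | apply: whisk_heq | apply: comp_heq ].

(** * The braiding against units, counits and products *)

Section Braid.
Variable V : strict_braided.
Implicit Types A B D X Y : V.

Lemma braid_heq A B B' : B = B' -> braid A B ≈ braid A B'.
Proof. by move=> <-; exact: heq_refl. Qed.

Lemma braid_heql A A' B : A = A' -> braid A B ≈ braid A' B.
Proof. by move=> <-; exact: heq_refl. Qed.

Lemma tensK A : A ⊗ 'K = 'K ⊗ A :> V.
Proof. by rewrite tens_unitl tens_unitr. Qed.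

(** The hexagon at ['K ⊗ 'K] makes this braiding idempotent up to invisible identities; being
    invertible, it is an identity. [braid_unitl] uses the other hexagon in the same way. *)
Lemma braid_unitr A : braid A 'K ≈ idm A.
Proof.
have c2 : braid A 'K ∘ (eqhom (eq_sym (tensK A)) ∘ braid A 'K) = braid A 'K.
  apply/heq_eq/heq_sym.
  apply: heq_trans (braid_heq _ (eq_sym (tens_unitl 'K))) _.
  rewrite braid_hexr -!compA; apply: heq_eqhoml.
  apply: heq_comp; first exact: heq_tens1l.
  apply: heq_eqhoml; apply: heq_eqhomr.
  apply: heq_trans (heq_tens1r _) _.
  exact/heq_sym/heq_eqhoml/heq_refl.
have [d [dK _]] := braid_iso A 'K.
have : eqhom (eq_sym (tensK A)) ∘ braid A 'K = idm _.
  by rewrite -[LHS]comp_idl -dK -compA c2.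
move/(f_equal (fun f => eqhom (tensK A) ∘ f)); rewrite comp_idr.
have -> : eqhom (tensK A) ∘ (eqhom (eq_sym (tensK A)) ∘ braid A 'K)
  = braid A 'K by apply/heq_eq/heq_eqhoml/heq_eqhoml/heq_refl.
move=> ->; apply: heq_trans (heq_eqhom _) _; rewrite -tensm_id.
exact: heq_tens1r.
Qed.

Lemma braid_unitl A : braid 'K A ≈ idm A.
Proof.
have c2 : braid 'K A ∘ (eqhom (tensK A) ∘ braid 'K A) = braid 'K A.
  apply/heq_eq/heq_sym.
  apply: heq_trans (braid_heql _ (eq_sym (tens_unitl 'K))) _.
  rewrite braid_hexl -!compA; apply: heq_eqhoml.
  apply: heq_comp; first exact: heq_tens1r.
  apply: heq_eqhoml; apply: heq_eqhomr.
  apply: heq_trans (heq_tens1l _) _.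
  exact/heq_sym/heq_eqhoml/heq_refl.
have [d [dK _]] := braid_iso 'K A.
have : eqhom (tensK A) ∘ braid 'K A = idm _.
  by rewrite -[LHS]comp_idl -dK -compA c2.
move/(f_equal (fun f => eqhom (eq_sym (tensK A)) ∘ f)); rewrite comp_idr.
have -> : eqhom (eq_sym (tensK A)) ∘ (eqhom (tensK A) ∘ braid 'K A)
  = braid 'K A by apply/heq_eq/heq_eqhoml/heq_eqhoml/heq_refl.
move=> ->; apply: heq_trans (heq_eqhom _) _; rewrite -tensm_id.
exact: heq_tens1l.
Qed.

Lemma heq_id_tens A B D X Y (f : D ⊗ X ~> Y) (g : A ~> B) :
  f ≈ idm D ⊗₁ idm X -> g ≈ idm D -> f ≈ g ⊗₁ idm X.
Proof.
move=> h /heq_sym g1; by apply: heq_trans h _; apply: heq_tens (heq_refl _).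
Qed.

(** Naturality carries [f] through the braiding and leaves a braiding with ['K], an invisible
    identity. The next two lemmas follow the same pattern. *)
Lemma br_op0r A B (f : 'K ~> B) X : br A B X ∘ (A ◁ op0 f X) = op0 f (A ⊗ X).
Proof.
apply: (@heq_uniq _ _ _ _ _ _ _ ((braid A B ∘ (A ◁ f)) ⊗₁ idm X)).
  by apply: comp_heq; [exact: br_heq|place].
rewrite braid_nat -[op0 _ _]comp_idr; apply: comp_heq.
  by apply: heq_trans (op0_heq _ _) _; place.
by apply: (@heq_id_tens _ _ A); rewrite ?tensm_id;
  [exact: heq_refl|exact: braid_unitr].
Qed.

Lemma br_op0l A B (f : 'K ~> A) X : br A B X ∘ op0 f (B ⊗ X) = B ◁ op0 f X.
Proof.
apply: (@heq_uniq _ _ _ _ _ _ _ ((braid A B ∘ (f ⊗₁ idm B)) ⊗₁ idm X)).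
  apply: comp_heq; first exact: br_heq.
  by apply: heq_trans (op0_heq _ _) _; place.
rewrite braid_nat -[B ◁ _]comp_idr; apply: comp_heq; first by place.
by apply: (@heq_id_tens _ _ B); rewrite ?tensm_id;
  [exact: heq_refl|exact: braid_unitl].
Qed.

Lemma br_cop0l A B (f : A ~> 'K) X : (B ◁ cop0 f X) ∘ br A B X = cop0 f (B ⊗ X).
Proof.
apply: (@heq_uniq _ _ _ _ _ _ _ (((B ◁ f) ∘ braid A B) ⊗₁ idm X)).
  by apply: comp_heq; [place|exact: br_heq].
rewrite -braid_nat -[cop0 _ _]comp_idl; apply: comp_heq.
  by apply: (@heq_id_tens _ _ B); rewrite ?tensm_id;
    [exact: heq_refl|exact: braid_unitl].
by apply: heq_trans (cop0_heq _ _) _; place.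
Qed.

(** Naturality carries [f] through the braiding; the hexagon then splits the braiding with [B ⊗ B']
    in two. *)
Lemma br_op2r A B B' D (f : B ⊗ B' ~> D) X :
  br A D X ∘ (A ◁ op2 f X)
  = op2 f (A ⊗ X) ∘ ((B ◁ br A B' X) ∘ br A B (B' ⊗ X)).
Proof.
apply: (@heq_uniq _ _ _ _ _ _ _ ((braid A D ∘ (A ◁ f)) ⊗₁ idm X)).
  by apply: comp_heq; [exact: br_heq|place].
rewrite braid_nat; apply: comp_heq.
  by apply: heq_trans (op2_heq _ _) _; place.
have -> : braid A (B ⊗ B') = assoc B B' A ∘ ((B ◁ braid A B') ∘ br A B B').
  by rewrite braid_hexr brE !compA.
rewrite tensm_idD; apply/heq_sym/heq_eqhom_tensl/heq_sym/comp_heq; last exact: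
  br_shift.
apply: whisk_heq; exact: br_heq.
Qed.

Lemma br_op2l A B B' D (f : B ⊗ B' ~> D) X :
  br D A X ∘ op2 f (A ⊗ X)
  = (A ◁ op2 f X) ∘ (br B A (B' ⊗ X) ∘ (B ◁ br B' A X)).
Proof.
apply: (@heq_uniq _ _ _ _ _ _ _ ((braid D A ∘ (f ⊗₁ idm A)) ⊗₁ idm X)).
  apply: comp_heq; first exact: br_heq.
  by apply: heq_trans (op2_heq _ _) _; place.
rewrite braid_nat; apply: comp_heq; first by place.
have -> : braid (B ⊗ B') A
  = (br B A B' ∘ (B ◁ braid B' A)) ∘ assoc_inv B B' A.
  by rewrite brE braid_hexl.
rewrite tensm_idD; apply/heq_sym/heq_eqhom_tensr/heq_sym/comp_heq; first exact:
  br_shift.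
apply: whisk_heq; exact: br_heq.
Qed.

(** Bridge from [midbraid], as it occurs in the definitions, to right-bracketed composites with one
    whiskered braiding. *)
Lemma mid_placed A B D X A' B' Y Z (f : A ⊗ D ~> A') (g : B ⊗ X ~> B')
    (h : Y ~> A ⊗ B) (k : Z ~> D ⊗ X) :
  (f ⊗₁ g) ∘ midbraid A B D X ∘ (h ⊗₁ k)
  = op2 f B' ∘ ((A ◁ D ◁ g) ∘ ((A ◁ br B D X) ∘ (cop2 h (D ⊗ X) ∘ (Y ◁ k)))).
Proof.
have e : ((A ⊗ D) ◁ g) ∘ assoc A D (B ⊗ X) = assoc A D B' ∘ (A ◁ D ◁ g).
  by rewrite -tensm_id; exact/esym/tensm_assoc.
rewrite (tens_split h) (tens_split f) /midbraid op2E cop2E -!compA.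
by rewrite (compA ((A ⊗ D) ◁ g)) e brE -!compA.
Qed.

Lemma tens_id_nat A B X Y (f : A ~> B) (g : X ~> Y) :
  (f ⊗₁ idm Y) ∘ (A ◁ g) = (B ◁ g) ∘ (f ⊗₁ idm X).
Proof. by rewrite -tens_split -tens_splitr. Qed.

End Braid.

Section Truss.
Variables (V : strict_braided) (H : hopf_truss V).
Implicit Types X Y M : V.

Notation "'μ'" := (op2 (ht_mu1 H)).
Notation "'ν'" := (op2 (ht_mu2 H)).
Notation "'η'" := (op0 (ht_eta H)).
Notation "'ε'" := (cop0 (counit H)).
Notation "'δ'" := (cop2 (coprod H)).
Notation "'λ' X" := (ht_lam H ⊗₁ idm X) (at level 10, X at level 9).
Notation "'σ' X" := (ht_sigma H ⊗₁ idm X) (at level 10, X at level 9).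
Notation "'τ'" := (@br V H H).

Let bim := hopf_bimonoid (ht_hopf H).
Let mon1 := bim_monoid bim.
Let com := bim_comonoid bim.

(** * The axioms of a Hopf truss in right-bracketed form *)

Lemma op2_assoc (m : H ⊗ H ~> H) X :
  is_assoc m -> op2 m X ∘ (H ◁ op2 m X) = op2 m X ∘ op2 m (H ⊗ X).
Proof.
move=> a; apply: (@heq_uniq _ _ _ _ _ _ _ ((m ∘ (H ◁ m)) ⊗₁ idm X)); first by
  place.
by rewrite a -compA -op2E; place.
Qed.

Lemma muA X : μ X ∘ (H ◁ μ X) = μ X ∘ μ (H ⊗ X).
Proof. exact/op2_assoc/(monoid_assoc mon1). Qed.

Lemma nuA X : ν X ∘ (H ◁ ν X) = ν X ∘ ν (H ⊗ X).
Proof. exact/op2_assoc/(nub_assoc (ht_bimonoid H)). Qed.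

Lemma mu_etal X : μ X ∘ η (H ⊗ X) = idm _.
Proof.
apply: (@heq_uniq _ _ _ _ _ _ _ ((ht_mu1 H ∘ op0 (ht_eta H) H) ⊗₁ idm X)).
  by place.
rewrite op0E compA (monoid_unitl mon1) -tensm_id.
by apply: heq_tens (heq_refl _); apply/heq_sym/heq_eqhoml; exact: heq_eqhom.
Qed.

Lemma mu_etar X : μ X ∘ (H ◁ η X) = idm _.
Proof.
apply: (@heq_uniq _ _ _ _ _ _ _ ((ht_mu1 H ∘ (H ◁ ht_eta H)) ⊗₁ idm X)).
  by place.
rewrite (monoid_unitr mon1) -tensm_id.
by apply: heq_tens (heq_refl _); apply/heq_sym; exact: heq_eqhom_cod.
Qed.

Lemma deA X : δ (H ⊗ X) ∘ δ X = (H ◁ δ X) ∘ δ X.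
Proof.
apply: (@heq_uniq _ _ _ _ _ _ _ ((cop2 (coprod H) H ∘ coprod H) ⊗₁ idm X)).
  by place.
have -> : cop2 (coprod H) H ∘ coprod H = (H ◁ coprod H) ∘ coprod H.
  rewrite cop2E -compA (coprod_coassoc com) !compA.
  by rewrite assocK comp_idl.
by place.
Qed.

Lemma ep_del X : ε (H ⊗ X) ∘ δ X = idm _.
Proof.
apply: (@heq_uniq _ _ _ _ _ _ _ ((cop0 (counit H) H ∘ coprod H) ⊗₁ idm X)).
  by place.
by rewrite cop0E (counit_coprodl com) tensm_id; exact: heq_refl.
Qed.

Lemma ep_der X : (H ◁ ε X) ∘ δ X = idm _.
Proof.
apply: (@heq_uniq _ _ _ _ _ _ _
  ((runit H ∘ (H ◁ counit H) ∘ coprod H) ⊗₁ idm X)).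
  rewrite -compA tensm_idD; apply/heq_sym/heq_eqhom_tensl/heq_sym; by place.
by rewrite (counit_coprodr com) tensm_id; exact: heq_refl.
Qed.

Lemma ep_eta X : ε X ∘ η X = idm X.
Proof.
apply: (@heq_uniq _ _ _ _ _ _ _ ((counit H ∘ ht_eta H) ⊗₁ idm X)).
  by place.
rewrite (bim_eta bim).1 /=; exact/heq_sym/heq_tens1l.
Qed.

Lemma de_eta X : δ X ∘ η X = η (H ⊗ X) ∘ η X.
Proof.
apply: (@heq_uniq _ _ _ _ _ _ _ ((coprod H ∘ ht_eta H) ⊗₁ idm X)).
  by place.
rewrite (bim_eta bim).2 /=.
(* The coproduct of ['K] is an invisible identity, so η ⊗ η amounts to two successive units. *)
have -> : (ht_eta H ⊗₁ ht_eta H) ∘ lunit_inv 'K = op0 (ht_eta H) H ∘ ht_eta H.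
  rewrite (tens_split (ht_eta H)) op0E -!compA; congr (_ ∘ _).
  apply/heq_eq/heq_eqhomr/heq_sym/heq_eqhoml/heq_sym; exact: heq_tens1l.
by place.
Qed.

(** Kept general in [m] because it serves both products. *)
Lemma de_mult (m : H ⊗ H ~> H) X : @is_comonoid_mor _ (tens_comonoid H H) H m ->
  δ X ∘ op2 m X = op2 m (H ⊗ X) ∘ ((H ◁ H ◁ op2 m X) ∘
    ((H ◁ τ (H ⊗ X)) ∘ (δ (H ⊗ H ⊗ X) ∘ (H ◁ δ X)))).
Proof.
case=> _ e; apply: (@heq_uniq _ _ _ _ _ _ _ ((coprod H ∘ m) ⊗₁ idm X)).
  by place.
by rewrite e /= (compA (m ⊗₁ m)) mid_placed; place.
Qed.

Lemma ep_mult (m : H ⊗ H ~> H) X : @is_comonoid_mor _ (tens_comonoid H H) H m ->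
  ε X ∘ op2 m X = ε X ∘ ε (H ⊗ X).
Proof.
case=> e _; apply: (@heq_uniq _ _ _ _ _ _ _ ((counit H ∘ m) ⊗₁ idm X)).
  by place.
rewrite e /=.
have -> : lunit 'K ∘ (counit H ⊗₁ counit H) = counit H ∘ cop0 (counit H) H.
  rewrite (tens_splitr (counit H)) cop0E !compA; congr (_ ∘ _).
  apply/heq_eq/heq_eqhoml/heq_sym/heq_eqhomr/heq_sym; exact: heq_tens1l.
by place.
Qed.

Lemma de_sigma X : δ X ∘ σ X = σ (H ⊗ X) ∘ ((H ◁ σ X) ∘ δ X).
Proof.
apply: (@heq_uniq _ _ _ _ _ _ _ ((coprod H ∘ ht_sigma H) ⊗₁ idm X)).
  by place.
by rewrite (ht_sigma_mor H).2 (tens_split (ht_sigma H) (ht_sigma H)) -compA;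
  place.
Qed.

Lemma ep_sigma X : ε X ∘ σ X = ε X.
Proof. by rewrite cop0E -compA -tensm_idD (ht_sigma_mor H).1. Qed.

Lemma antil X : μ X ∘ (λ (H ⊗ X) ∘ δ X) = η X ∘ ε X.
Proof.
apply: (@heq_uniq _ _ _ _ _ _ _
  ((ht_mu1 H ∘ ((λ H) ∘ coprod H)) ⊗₁ idm X)); first by place.
by rewrite compA (hopf_antipodel (ht_hopf H)); place.
Qed.

Lemma antir X : μ X ∘ ((H ◁ λ X) ∘ δ X) = η X ∘ ε X.
Proof.
apply: (@heq_uniq _ _ _ _ _ _ _
  ((ht_mu1 H ∘ ((H ◁ ht_lam H) ∘ coprod H)) ⊗₁ idm X)); first by place.
by rewrite compA (hopf_antipoder (ht_hopf H)); place.
Qed.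

Lemma Gamma_placed M (p1 p2 : H ⊗ M ~> M) :
  Gamma (ht_lam H) (ht_sigma H) p1 p2
  = p1 ∘ (λ M ∘ (σ M ∘ ((H ◁ p2) ∘ δ M))).
Proof. by rewrite /Gamma tens_split cop2E tensm_idD -!compA. Qed.

Lemma compat_placed M (p1 g : H ⊗ M ~> M) :
  p1 ∘ (ht_mu2 H ⊗₁ g) ∘ midbraid H H H M ∘ (coprod H ⊗₁ idm (H ⊗ M))
  = p1 ∘ (ν M ∘ ((H ◁ H ◁ g) ∘ ((H ◁ τ M) ∘ δ (H ⊗ M)))).
Proof.
have := mid_placed (ht_mu2 H) g (coprod H) (idm (H ⊗ M)).
by rewrite tensm_id comp_idr => <-; rewrite -!compA.
Qed.

Lemma truss_compat X :
  ν X ∘ (H ◁ μ X)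
  = μ X ∘ (ν (H ⊗ X) ∘ ((H ◁ H ◁ (μ X ∘ (λ (H ⊗ X) ∘ (σ (H ⊗ X) ∘
     ((H ◁ ν X) ∘ δ (H ⊗ X)))))) ∘ ((H ◁ τ (H ⊗ X)) ∘ δ (H ⊗ H ⊗ X)))).
Proof.
apply: (@heq_uniq _ _ _ _ _ _ _ ((ht_mu2 H ∘ (H ◁ ht_mu1 H)) ⊗₁ idm X)).
  by place.
by rewrite (ht_compat H) compat_placed Gamma_placed; place.
Qed.

(** * The second product with the unit is σ *)

Definition nu_unit X : H ⊗ X ~> H ⊗ X := locked_with placed_key (ν X ∘ (H ◁ η X)).
(** With s for [nu_unit], this is the convolution product of S ∘ σ and s, that is, Γ(-, 1). *)
Definition Gamma_unit X : H ⊗ X ~> H ⊗ X := locked_with placed_key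
  (μ X ∘ (λ (H ⊗ X) ∘ (σ (H ⊗ X) ∘ ((H ◁ nu_unit X) ∘ δ X)))).

Lemma nu_unit_def X : nu_unit X = ν X ∘ (H ◁ η X).
Proof. exact: locked_withE. Qed.

Lemma Gamma_unit_def X :
  Gamma_unit X = μ X ∘ (λ (H ⊗ X) ∘ (σ (H ⊗ X) ∘ ((H ◁ nu_unit X) ∘ δ X))).
Proof. exact: locked_withE. Qed.

Lemma nu_unit_nat X Y (g : X ~> Y) : nu_unit Y ∘ (H ◁ g) = (H ◁ g) ∘ nu_unit X.
Proof.
by rewrite !nu_unit_def -compA -whiskD op0_nat whiskD compA op2_nat -compA.
Qed.

(** Holds because the second product is a comonoid morphism and the unit is grouplike. *)
Lemma de_nu_unit X :
  δ X ∘ nu_unit X = nu_unit (H ⊗ X) ∘ ((H ◁ nu_unit X) ∘ δ X).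
Proof.
rewrite !nu_unit_def compA (de_mult _ (nub_mu (ht_bimonoid H))) -!compA.
rewrite -whiskD de_eta whiskD (pre21 (cop2_nat _ _)) -!compA cop2_nat.
rewrite (pre21 (wh21 H (br_op0r _ _ _))) (pre21 (wh21 H (esym (op0_nat _ _)))).
by rewrite !whiskD -!compA.
Qed.

Lemma ep_nu_unit X : ε X ∘ nu_unit X = ε X.
Proof.
rewrite !nu_unit_def compA (ep_mult _ (nub_mu (ht_bimonoid H))) -compA cop0_nat
  compA.
by rewrite ep_eta comp_idl.
Qed.

(** This is s * Γ(-, 1) = s, obtained from the truss axiom at h ∘ (1 · 1). *)
Lemma nu_unit_conv X :
  μ X ∘ (nu_unit (H ⊗ X) ∘ ((H ◁ Gamma_unit X) ∘ δ X)) = nu_unit X.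
Proof.
have Gamma_eta : μ X ∘ (λ (H ⊗ X) ∘ (σ (H ⊗ X) ∘ ((H ◁ ν X) ∘ δ (H ⊗ X))))
    ∘ (H ◁ η X) = Gamma_unit X.
  by rewrite Gamma_unit_def -!compA cop2_nat
    (pre21 (wh21 H (esym (nu_unit_def X)))).
have := truss_compat X.
move/(f_equal (fun f => f ∘ ((H ◁ H ◁ η X) ∘ (H ◁ η X)))).
rewrite -!compA (pre21 (wh21 H (mu_etar X))) tensm_id comp_idl -nu_unit_def.
move=> ->.
rewrite (pre22 (cop2_nat _ _)) cop2_nat (pre22 (wh22 H (br_nat _ _ _))).
rewrite (pre21 (wh21 H (br_op0r _ _ _))) (pre21 (wh21 H (wh21 H Gamma_eta))).
by rewrite (pre22 (wh22 H (esym (op0_nat _ _)))) (pre21 (esym (nu_unit_def _))).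
Qed.

(** As s is a comonoid morphism, S ∘ s is a left convolution inverse of s and cancels it in s * Γ(-,
    1) = s. *)
Lemma Gamma_unitE X : Gamma_unit X = η X ∘ ε X.
Proof.
have <- : μ X ∘ (λ (H ⊗ X) ∘ (nu_unit (H ⊗ X) ∘ ((H ◁ nu_unit X) ∘ δ X)))
    = η X ∘ ε X.
  by rewrite -de_nu_unit (pre32 (antil X)) ep_nu_unit.
rewrite -{1}(nu_unit_conv X) !whiskD -!compA -deA (pre22 (esym (cop2_nat _ _))).
rewrite (pre22 (nu_unit_nat _)) (pre22 (tens_id_nat _ _)) (pre22 (muA _)).
rewrite (pre32 (esym (de_nu_unit _))) (pre32 (antil _)) (pre21 (mu_etal _))
  comp_idl.
by rewrite (pre21 (ep_nu_unit _)) (pre22 (cop0_nat _ _)) ep_del comp_idr.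
Qed.

(** Since Γ(-, 1) is the convolution unit, σ = σ * (S ∘ σ) * s; and S ∘ σ is a right inverse of σ, a
    comonoid morphism. *)
Lemma nu_unit_sigma X : nu_unit X = σ X.
Proof.
have -> : σ X = μ X ∘ (σ (H ⊗ X) ∘ ((H ◁ Gamma_unit X) ∘ δ X)).
  rewrite Gamma_unitE whiskD -!compA (pre22 (tens_id_nat _ _))
    (pre21 (mu_etar _)) comp_idl.
  by rewrite ep_der comp_idr.
rewrite Gamma_unit_def !whiskD -!compA -deA (pre22 (esym (cop2_nat _ _))).
rewrite (pre22 (tens_id_nat _ _)) (pre22 (muA _)) (pre22 (tens_id_nat _ _)).
rewrite (pre32 (esym (de_sigma _))) (pre32 (antir _)) (pre21 (mu_etal _))
  comp_idl.
by rewrite (pre21 (ep_sigma _)) (pre22 (cop0_nat _ _)) ep_del comp_idr.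
Qed.

Lemma nu_etar X : ν X ∘ (H ◁ η X) = σ X.
Proof. by rewrite -nu_unit_def nu_unit_sigma. Qed.

(** * Free Hopf modules over a Hopf truss *)

Lemma nonunital_moduleE (m : H ⊗ H ~> H) M (p : H ⊗ M ~> M) :
  is_nonunital_module m p <-> p ∘ (H ◁ p) = p ∘ op2 m M.
Proof. by rewrite /is_nonunital_module -compA -op2E. Qed.

Lemma moduleE M (p : H ⊗ M ~> M) :
  is_module (ht_eta H) (ht_mu1 H) p
  <-> p ∘ (H ◁ p) = p ∘ μ M /\ p ∘ η M = idm M.
Proof.
split=> -[/nonunital_moduleE a e]; split=> //.
  by rewrite op0E compA e; apply/heq_eq/heq_eqhoml/heq_eqhom.
apply/heq_eq/heq_sym; apply: heq_trans (heq_eqhom_cod _) _.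
rewrite -[X in X ≈ _]e; apply: heq_comp (heq_refl _) _; exact: op0_heq.
Qed.

Lemma comoduleE M (r : M ~> H ⊗ M) :
  is_comodule r <-> δ M ∘ r = (H ◁ r) ∘ r /\ ε M ∘ r = idm M.
Proof.
rewrite /is_comodule cop2E cop0E; split=> -[e ->]; split=> //.
  by rewrite -compA e !compA assocK comp_idl.
rewrite -[RHS]compA -e !compA.
have -> : assoc H H M ∘ assoc_inv H H M = idm _.
  exact/heq_eq/heq_eqhoml/heq_eqhom.
by rewrite comp_idl.
Qed.

Lemma hopf_compatE (m : H ⊗ H ~> H) M (p : H ⊗ M ~> M) (r : M ~> H ⊗ M) :
  hopf_compat m p r
  <-> r ∘ p = op2 m M ∘ ((H ◁ H ◁ p) ∘
         ((H ◁ τ M) ∘ (δ (H ⊗ M) ∘ (H ◁ r)))).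
Proof. by rewrite /hopf_compat mid_placed. Qed.

Lemma free_truss_module X : is_truss_module (μ X) (ν X).
Proof.
split.
- by apply/moduleE; split; [exact: muA|exact: mu_etal].
- exact/nonunital_moduleE/nuA.
- by rewrite compat_placed Gamma_placed truss_compat.
Qed.

(** Applying H ⊗ ε to the hypothesis shows that coinvariants of the free module have the form 1 ⊗ x.
    There both sides are σ(h) ⊗ x, by [mu_etar] and [nu_etar]. *)
Lemma free_coinv X Y (j : Y ~> H ⊗ X) :
  δ X ∘ j = η (H ⊗ X) ∘ j -> μ X ∘ (ht_sigma H ⊗₁ j) = ν X ∘ (H ◁ j).
Proof.
move/(f_equal (fun f => (H ◁ ε X) ∘ f)).
rewrite (pre21 (ep_der X)) comp_idl (pre22 (esym (op0_nat _ _))) => ->.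
rewrite tens_split !whiskD (pre22 (tens_id_nat _ _)) (pre21 (mu_etar _))
  comp_idl.
by rewrite (pre21 (nu_etar _)).
Qed.

Variable E : equalizers V.

Lemma free_truss_hopf_spec X : is_truss_hopf_module E (free_truss_hopf H X).
Proof.
have e1 : psi1 (free_truss_hopf H X) = μ X by rewrite op2E.
have e2 : psi2 (free_truss_hopf H X) = ν X by rewrite op2E.
have e3 : rho (free_truss_hopf H X) = δ X by rewrite cop2E.
have com_de : is_comodule (δ X).
  by apply/comoduleE; split; [exact: deA|exact: ep_del].
have [tm1 tm2 tm3] := free_truss_module X.
split; rewrite ?e1 ?e2 ?e3 //.
- split=> //; apply/hopf_compatE; exact/de_mult/(bim_mu bim).
- split=> //; apply/hopf_compatE; exact/de_mult/(nub_mu (ht_bimonoid H)).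
apply: free_coinv; rewrite -e3 op0E; exact: (eqz_spec E _ _).1.
Qed.

(** * The projection onto the coinvariants *)

Section HopfModule.
Variables (M : V) (p : H ⊗ M ~> M) (r : M ~> H ⊗ M).
Hypothesis pA : p ∘ (H ◁ p) = p ∘ μ M.
Hypothesis pη : p ∘ η M = idm M.
Hypothesis rA : δ M ∘ r = (H ◁ r) ∘ r.
Hypothesis εr : ε M ∘ r = idm M.
Hypothesis rp : r ∘ p = μ M ∘ ((H ◁ H ◁ p) ∘
                  ((H ◁ τ M) ∘ (δ (H ⊗ M) ∘ (H ◁ r)))).

(** The diagonal action h · (k ⊗ m) = h_1 k ⊗ h_2 m. *)
Definition diag : H ⊗ H ⊗ M ~> H ⊗ M := locked_with placed_key
  (μ M ∘ ((H ◁ H ◁ p) ∘ ((H ◁ τ M) ∘ δ (H ⊗ M)))).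

Lemma diagE : diag = μ M ∘ ((H ◁ H ◁ p) ∘ ((H ◁ τ M) ∘ δ (H ⊗ M))).
Proof. exact: locked_withE. Qed.

Lemma diag_coact : diag ∘ (H ◁ r) = r ∘ p.
Proof. by rewrite rp diagE -!compA. Qed.

Lemma diag_etar : diag ∘ (H ◁ η M) = (H ◁ p) ∘ δ M.
Proof.
rewrite diagE -!compA cop2_nat (pre21 (wh21 H (br_op0r _ _ _))).
by rewrite (pre22 (wh22 H (esym (op0_nat _ _)))) (pre21 (mu_etar _)) comp_idl.
Qed.

Lemma diag_etal : diag ∘ η (H ⊗ M) = idm _.
Proof.
rewrite diagE -!compA de_eta op0_nat (pre21 (wh21 H (br_op0l _ _ _))).
by rewrite (pre21 (wh21 H (wh21 H pη))) !tensm_id comp_idl mu_etal.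
Qed.

Lemma diagA : diag ∘ (H ◁ diag) = diag ∘ μ (H ⊗ M).
Proof.
(* On both sides coproducts move to the right and products to the left; the braidings pass the
   products by the hexagons, and naturality matches what remains. *)
rewrite diagE !whiskD -!compA (de_mult _ (bim_mu bim)).
rewrite (pre22 (cop2_nat _ _)) (pre22 (cop2_nat _ _)) (pre22 (cop2_nat _ _)).
rewrite (pre21 (wh21 H (br_op2r _ _ _))) !whiskD -!compA.
rewrite (pre22 (wh22 H (esym (op2_nat _ _)))) (pre22 (muA _)).
rewrite (pre22 (wh22 H (br_nat _ _ _)))
  (pre22 (wh22 H (wh22 H (br_nat _ _ _)))).
rewrite (pre22 (wh22 H (br_nat _ _ (τ M)))).
rewrite [in RHS](pre22 (esym (op2_nat _ (τ M))))
  [in RHS](pre22 (esym (op2_nat _ (H ◁ p)))).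
rewrite [in RHS](pre21 (wh21 H (wh21 H (br_op2l _ _ _)))) !whiskD -!compA.
by rewrite (pre22 (wh22 H (wh22 H (wh22 H pA)))).
Qed.

(** The claim [K] exhibits a left inverse of a ↦ m_{-1} · a(m_0), namely b ↦ S(m_{-1}) · b(m_0). *)
Lemma diag_inj (a b : M ~> H ⊗ M) :
  diag ∘ ((H ◁ a) ∘ r) = diag ∘ ((H ◁ b) ∘ r) -> a = b.
Proof.
suff K c : diag ∘ (λ (H ⊗ M) ∘ ((H ◁ (diag ∘ ((H ◁ c) ∘ r))) ∘ r)) = c.
  by move=> e; rewrite -(K a) -(K b) e.
rewrite !whiskD -!compA -rA (pre22 (esym (cop2_nat _ _))).
rewrite (pre22 (tens_id_nat _ _)) (pre22 diagA).
rewrite (pre32 (antil _)) (pre21 diag_etal) comp_idl.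
by rewrite (pre22 (cop0_nat _ _)) εr comp_idr.
Qed.

(** The map q with values in [M]; it is factored through the coinvariants in [coinv_act_iso]. *)
Definition coproj : M ~> M := locked_with placed_key (p ∘ (λ M ∘ r)).

Lemma coprojE : coproj = p ∘ (λ M ∘ r).
Proof. exact: locked_withE. Qed.

Lemma coproj_id : p ∘ ((H ◁ coproj) ∘ r) = idm M.
Proof.
rewrite coprojE !whiskD -!compA -rA (pre22 pA).
by rewrite (pre32 (antir _)) (pre21 pη) comp_idl εr.
Qed.

(** Under [diag_inj] the left side becomes the coaction of m_{-1} q(m_0) = m, and the right side
    becomes m_{-2} ⊗ m_{-1} q(m_0), which is again the coaction of m. *)
Lemma coproj_coinv : r ∘ coproj = η M ∘ coproj.
Proof.
apply: diag_inj; rewrite !whiskD -!compA (pre22 diag_coact) coproj_id comp_idr.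
rewrite (pre22 diag_etar) (pre22 (cop2_nat _ _)) rA.
by rewrite !compA -!whiskD -compA coproj_id tensm_id comp_idl.
Qed.

Variables (X : V) (j : X ~> M).
Hypothesis rj : r ∘ j = η M ∘ j.

(** For coinvariant x the coaction of h x is h · (1 ⊗ x) = h_1 ⊗ h_2 x. *)
Lemma coinv_act_colin : r ∘ (p ∘ (H ◁ j)) = (H ◁ (p ∘ (H ◁ j))) ∘ δ X.
Proof.
rewrite whiskD -!compA (pre22 (esym diag_coact)) -whiskD rj whiskD.
by rewrite (pre22 diag_etar) cop2_nat.
Qed.

(** By the previous formula, q(h x) = S(h_1) h_2 x = ε(h) x. *)
Lemma coproj_act : coproj ∘ (p ∘ (H ◁ j)) = j ∘ ε X.
Proof.
rewrite coprojE -!compA coinv_act_colin whiskD -!compA.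
rewrite !(pre22 (tens_id_nat _ _)) (pre22 pA) (pre22 (op2_nat _ _)) antil.
by rewrite (pre22 (esym (op0_nat _ _))) (pre21 pη) comp_idl.
Qed.

Lemma act_mu : (p ∘ (H ◁ j)) ∘ μ X = p ∘ (H ◁ (p ∘ (H ◁ j))).
Proof. by rewrite -compA -op2_nat (pre22 (esym pA)) whiskD. Qed.

Variable p2 : H ⊗ M ~> M.
Hypothesis p2p : p2 ∘ (H ◁ p)
  = p ∘ (ν M ∘ ((H ◁ H ◁ (p ∘ (λ M ∘ (σ M ∘ ((H ◁ p2) ∘ δ M))))) ∘
      ((H ◁ τ M) ∘ δ (H ⊗ M)))).
Hypothesis p2j : p ∘ (ht_sigma H ⊗₁ j) = p2 ∘ (H ◁ j).

Lemma act_nu : (p ∘ (H ◁ j)) ∘ ν X = p2 ∘ (H ◁ (p ∘ (H ◁ j))).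
Proof.
(* For x coming from [j] the second action is the first one through σ, whence Γ(h, x) = S(σ(h_1))
   σ(h_2) x = ε(h) x. *)
have e : p ∘ (λ M ∘ (σ M ∘ ((H ◁ p2) ∘ δ M))) ∘ (H ◁ j) = j ∘ ε X.
  rewrite -!compA cop2_nat (pre21 (wh21 H (esym p2j)))
    (tens_split (ht_sigma H) j).
  rewrite !whiskD -!compA -cop2_nat !(pre22 (tens_id_nat _ p)) (pre22 pA).
  rewrite (pre32 (esym (de_sigma _))) (pre32 (antil _)) (pre21 pη) comp_idl.
  by rewrite (pre21 (ep_sigma _)) cop0_nat.
(* With this value of Γ the truss axiom for h ∘ (k x) collapses to (h ∘ k) x. *)
rewrite whiskD (pre22 p2p) -!compA cop2_nat (pre22 (wh22 H (br_nat _ _ _))).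
rewrite (pre21 (wh21 H (wh21 H e))) !whiskD -!compA
  (pre21 (wh21 H (br_cop0l _ _ _))).
by rewrite ep_der comp_idr op2_nat.
Qed.

End HopfModule.

(** * The isomorphism with the free Hopf module on the coinvariants *)

Lemma truss_hopf_mor_inv (M N : truss_hopf_data H) (f : M ~> N) (g : N ~> M) :
  is_truss_hopf_mor f -> g ∘ f = idm M -> f ∘ g = idm N -> is_truss_hopf_mor g.
Proof.
case=> f1 f2 f3 gf fg; split.
- rewrite -[psi1 N]comp_idr -tensm_id -fg whiskD (pre22 (esym f1)) compA gf.
  by rewrite comp_idl.
- rewrite -[psi2 N]comp_idr -tensm_id -fg whiskD (pre22 (esym f2)) compA gf.
  by rewrite comp_idl.
- rewrite -[rho N]comp_idr -fg (pre21 f3) !compA (wh21 H gf) tensm_id.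
  by rewrite comp_idl.
Qed.

Lemma coinv_act_iso (M : truss_hopf_data H) (X : V) (j : X ~> M) :
  is_truss_module (psi1 M) (psi2 M) ->
  is_hopf_module (ht_eta H) (ht_mu1 H) (psi1 M) (rho M) ->
  is_equalizer (rho M) (η M) j ->
  psi1 M ∘ (ht_sigma H ⊗₁ j) = psi2 M ∘ (H ◁ j) ->
  exists (f : free_truss_hopf H X ~> M) (g : M ~> free_truss_hopf H X),
    [/\ is_truss_hopf_mor f, f ∘ g = idm _ & g ∘ f = idm _].
Proof.
case=> /moduleE [pA pη] _ p2p [_ /comoduleE [rA εr] /hopf_compatE rp] [rj uj] p2j.
rewrite compat_placed Gamma_placed in p2p.
(* Uniqueness in the equalizer makes [j] a monomorphism. *)
have j_inj Y (h k : Y ~> X) : j ∘ h = j ∘ k -> h = k.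
  move=> e; have [|l [_ l1]] := uj Y (j ∘ h); first by rewrite !compA rj.
  by rewrite -(l1 h) // -(l1 k).
have [|pr [jpr _]] := uj M (coproj (psi1 M) (rho M)).
  exact: coproj_coinv.
have ract := coinv_act_colin rp rj.
(* The maps h ⊗ x ↦ h x and m ↦ m_{-1} ⊗ pr(m_0), where [pr] is q with values in the
   coinvariants. *)
exists (psi1 M ∘ (H ◁ j)), ((H ◁ pr) ∘ rho M); split.
- split; rewrite /= -?op2E -?cop2E //.
  + exact: act_mu.
  + exact: act_nu.
- by rewrite -compA (pre21 (wh21 H jpr)); exact: coproj_id.
(* It remains to see that pr(h x) = ε(h) x, which is checked after composing with [j]. *)
rewrite -compA ract (pre21 (wh21 H (_ : _ = ε _))) ?ep_der //.
apply: j_inj; rewrite compA jpr; exact: coproj_act.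
Qed.

End Truss.

Theorem theorem5p9 (C : strict_braided) (E : equalizers C) (H : hopf_truss C)
    (M : HopfMod E H) :
  exists FM : is_truss_hopf_module E
                (free_truss_hopf H (coinv E (thm_data M))),
    isomorphic M (TrussHopfModule FM : HopfMod E H).
Proof.
have FM := free_truss_hopf_spec H E (coinv E (thm_data M)); exists FM.
have [tm hm _ co] := thm_spec M.
have [|f [g [fM fg gf]]] := coinv_act_iso tm hm _ co.
  by rewrite op0E; exact: eqz_spec.
(* Linearity and colinearity are known for [f]; its inverse [g], which is the required arrow out of
   [M], inherits them. *)
have gM := truss_hopf_mor_inv fM gf fg.
exists (@TrussHopfHom _ _ _ M (TrussHopfModule FM) g gM).
exists (@TrussHopfHom _ _ _ (TrussHopfModule FM) M f fM).
by split; apply: truss_hopf_hom_eq.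
Qed.
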